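(* Assume $\theta=0$, keep the number $N$ of time steps and $\sigma$ fixed, and let $0\le n\le N-1$. Consider pairs $(dt,K)$ with constant product $dt\cdot K$, and suppose the holding costs are functions $h_{t_i}=h_{t_i}(dt,K)$ that, for $n\le i\le N-1$, are linear in $\sqrt{K}$ and in $1/\sqrt{dt}$ along such pairs, i.e. $h_{t_i}(C\,dt_0,K_0/C)=\tfrac{1}{\sqrt{C}}\,h_{t_i}(dt_0,K_0)$ for all $C>0$. Then $b(t_n)$ is linear in $\sqrt{dt}$ and in $1/\sqrt{K}$: for all $C>0$, $$b(t_n;dt=C\,dt_0,K=K_0/C)=\sqrt{C}\cdot b(t_n;dt=dt_0,K=K_0),$$ where $b(t_n;dt=d,K=k)$ denotes the threshold at the $n$-th grid point $t_n=n\cdot d$ in the purchasing problem described in the context with time step $dt=d$, reversion rate $K=k$ and holding costs $h_{t_i}(d,k)$.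
   Context: Model. A single item must be purchased within a finite horizon $[0,T]$. Decisions are made on the grid $t_n = n\cdot dt$, $0\le n\le N$, with $dt>0$ and $N=T/dt$. The item's price follows the AR(1) process $X_t = \theta K\,dt + (1-K\,dt)X_{t-dt} + \sigma\varepsilon_t$, where $\theta\in\mathbb{R}$, $\sigma>0$, $|1-K\,dt|<1$, and the $\varepsilon_{t_1},\varepsilon_{t_2},\dots$ are i.i.d. $N(0,dt)$. For $t_n<t_i$, $X_{t_n,t_i}(x)$ denotes the random price $X_{t_i}$ conditioned on $X_{t_n}=x$. Holding the item from $t_n$ to $t_N$ costs $dt\sum_{i=n}^{N-1}h_{t_i}$, where the per-unit-time holding costs $h_{t_0},\dots,h_{t_{N-1}}$ are real numbers that are weakly decreasing in time. Value function. $V(x,t_N)=x$ (the item must be bought at $t_N$ if not bought before), and for $0\le n<N$, $$V(x,t_n)=\min\Big\{V^C(x,t_n),\; x+dt\sum_{i=n}^{N-1}h_{t_i}\Big\},\qquad V^C(x,t_n)=E\big[V(X_{t_n,t_{n+1}}(x),t_{n+1})\big].$$ Threshold. For $0\le n\le N-1$, $b(t_n)$ is the (single) real number with $V^C(b(t_n),t_n)=b(t_n)+dt\sum_{i=n}^{N-1}h_{t_i}$; by convention $b(t_N)=\infty$. *)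

(* Defs.v *)
From HB Require Import structures.
From mathcomp Require Import all_boot all_order all_algebra finmap.
From mathcomp Require Import all_classical all_reals all_analysis.

Set Implicit Arguments.
Unset Strict Implicit.
Unset Printing Implicit Defensive.

Import Order.TTheory GRing.Theory Num.Theory.

Local Open Scope classical_set_scope.
Local Open Scope ring_scope.

Section Noise.
Context {d : measure_display} {Omega : measurableType d} {R : realType}
  {P : probability Omega R}.
Implicit Types eps : nat -> {RV P >-> R}.

Definition mutually_independent eps : Prop :=
  forall (I : {fset nat}) (A : nat -> set R), (forall i, measurable (A i)) ->
    P (\bigcap_(i in [set` I]) eps i @^-1` A i) =
    (\prod_(i <- I) P (eps i @^-1` A i))%E.

(* The second parameter of [normal_prob] is the standard deviation, so every
   [eps i] has variance [v]. *)
Definition iid_normal (v : R) eps : Prop :=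
  (forall i (A : set R), measurable A ->
    distribution P (eps i) A = normal_prob 0 (Num.sqrt v) A) /\
  mutually_independent eps.

End Noise.

(* The grid is t_n = n * dt for 0 <= n <= nsteps, and the horizon is
   T = nsteps * dt.  [cost i] is the holding cost per unit time at t_i; only its
   values for i < nsteps are used. *)
Record purchase (R : realType) := Purchase {
  dt : R;
  rate : R;        (* K *)
  theta : R;
  sigma : R;
  nsteps : nat;    (* N *)
  cost : nat -> R  (* h *)
}.

Definition admissible {R : realType} (p : purchase R) : Prop :=
  [/\ 0 < dt p, 0 < sigma p, `|1 - rate p * dt p| < 1
    & forall i j : nat, (i <= j)%N -> (j < nsteps p)%N -> cost p j <= cost p i].

Section Problem.
Context {d : measure_display} {Omega : measurableType d} {R : realType}
  {P : probability Omega R}.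
Variables (eps : nat -> {RV P >-> R}) (p : purchase R).

(* [price n x k] is the price at t_(n+k) of the process started from x at t_n.
   The indices of the innovations are shifted: [eps i] is the shock that drives
   the price from t_i to t_(i+1). *)
Fixpoint price (n : nat) (x : R) (k : nat) (w : Omega) : R :=
  if k is k'.+1 then
    theta p * rate p * dt p + (1 - rate p * dt p) * price n x k' w
      + sigma p * eps (n + k') w
  else x.

Definition holding (n : nat) : R :=
  dt p * \sum_(n <= i < nsteps p) cost p i.

(* [value_to_go m x] is the value at price x with m steps left before the
   horizon, that is, at time t_(nsteps - m).  The expectations are finite, since
   by induction the value function is 1-Lipschitz, so that [fine] loses
   nothing. *)
Fixpoint value_to_go (m : nat) (x : R) : R :=
  if m is m'.+1 then
    let n := (nsteps p - m'.+1)%N in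
    Num.min (fine 'E_P[fun w => value_to_go m' (price n x 1 w)])
            (x + holding n)
  else x.

Definition value (n : nat) (x : R) : R := value_to_go (nsteps p - n) x.

Definition cont_value (n : nat) (x : R) : R :=
  fine 'E_P[fun w => value n.+1 (price n x 1 w)].

Lemma value_last x : value (nsteps p) x = x.
Proof. by rewrite /value subnn. Qed.

Lemma valueE n x : (n < nsteps p)%N ->
  value n x = Num.min (cont_value n x) (x + holding n).
Proof.
move=> nN; rewrite /cont_value /value.
have -> : (nsteps p - n = (nsteps p - n.+1).+1)%N by rewrite subnSK.
by rewrite [LHS]/= subnSK // subKn // ltnW.
Qed.

(* For n < nsteps, admissible p and iid_normal (dt p) eps, exactly one b
   satisfies the equation, since cont_value n is Lipschitz with constant
   |1 - K dt| < 1; the default value 0 of [xget] is then never used. *)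
Definition threshold (n : nat) : R :=
  xget 0 [set b | cont_value n b = b + holding n].

End Problem.

(* Main.v *)
(* With c = sqrt C, a step with parameters (C dt0, K0/C) has the same reversion
   factor 1 - K dt as one with (dt0, K0), while its Gaussian shock and the total
   holding costs are multiplied by c. Backward induction gives
   V1(c x, t_i) = c V0(x, t_i) for i >= n, so multiplication by c maps the
   solutions of the threshold equation for (dt0, K0) onto those for
   (C dt0, K0/C). As the value functions are 1-Lipschitz, V^C is Lipschitz with
   constant |1 - K dt| < 1, so each equation has at most one solution. *)
Require Import Defs.
From HB Require Import structures.
From mathcomp Require Import all_boot all_order all_algebra finmap.
From mathcomp Require Import all_classical all_reals all_analysis.
From mathcomp Require Import measurable_realfun.
From mathcomp Require Import ring lra zify.

Set Implicit Arguments.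
Unset Strict Implicit.
Unset Printing Implicit Defensive.

Import Order.TTheory GRing.Theory Num.Theory.

Local Open Scope classical_set_scope.
Local Open Scope ring_scope.

(** * Dilations of Lebesgue measure and of centred normal laws *)

(** By uniqueness of Lebesgue measure: c^-1 times its pushforward under division by c gives []a, b]]
    the mass b - a. *)
Lemma lebesgue_measureZ (R : realType) (c : R) (A : set R) :
  0 < c -> measurable A ->
  lebesgue_measure (( *%R c^-1) @^-1` A) = (c%:E * lebesgue_measure A)%E.
Proof.
move=> c0 mA; have cV0 : 0 < c^-1 by rewrite invr_gt0.
pose phi : measurableTypeR R -> measurableTypeR R := *%R c^-1.
have mphi : measurable_fun [set: measurableTypeR R] phi.
  exact: measurable_funM.
have := @lebesgue_measure_unique R
  (mscale (NngNum (ltW cV0)) (pushforward (@lebesgue_measure R) phi)).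
move=> /(_ mphi) muE; rewrite [in RHS]muE//.
  by rewrite /mscale/= muleA -EFinM divff ?gt_eqF// mul1e.
move=> _ [[a b] _ <-] /=.
rewrite /mscale/= -[pushforward _ _ _]/(lebesgue_measure (phi @^-1` `]a, b])).
have phiE : phi @^-1` `]a, b] = `](c * a), (c * b)]%classic.
  apply/seteqP; split=> x; rewrite /phi /= !in_itv/=;
    by rewrite ltr_pdivlMl// ler_pdivrMl.
rewrite phiE !lebesgue_measure_itv/= !lte_fin ltr_pM2l//.
case: ifP => _; last by rewrite mule0.
by rewrite -!EFinD -EFinM -mulrBr mulKf// gt_eqF.
Qed.

(** [g] and the Radon-Nikodym derivative of [nu] have the same integral over every measurable set,
    so they agree almost everywhere. *)
Lemma change_of_variables_density (R : realType)
    (nu : {finite_measure set (measurableTypeR R) -> \bar R})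
    (g : R -> R) (f : R -> \bar R) :
  measurable_fun setT g -> (forall x, 0 <= g x) ->
  (forall A, measurable A ->
    nu A = (\int[lebesgue_measure]_(x in A) (g x)%:E)%E) ->
  measurable_fun setT f -> (forall x, 0 <= f x)%E ->
  (\int[nu]_x f x = \int[lebesgue_measure]_x (f x * (g x)%:E))%E.
Proof.
move=> mg g0 nuE mf f0.
have dom : nu `<< lebesgue_measure.
  apply/null_content_dominatesP => A mA A0; rewrite nuE//.
  by apply: null_set_integral => //; exact/measurable_EFinP/measurable_funTS.
have ig : lebesgue_measure.-integrable setT (EFin \o g).
  apply/integrableP; split; first exact/measurable_EFinP.
  under eq_integral do rewrite /= ger0_norm//.
  by rewrite -nuE// ltey_eq fin_num_measure.
rewrite -(Radon_Nikodym_SigmaFinite.change_of_variables dom)//.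
apply: ae_eq_integral => //.
- apply: emeasurable_funM => //.
  apply: (measurable_int lebesgue_measure).
  exact: Radon_Nikodym_SigmaFinite.f_integrable.
- by apply: emeasurable_funM => //; exact/measurable_EFinP.
suff : ae_eq lebesgue_measure setT
    (Radon_Nikodym_SigmaFinite.f nu lebesgue_measure) (EFin \o g).
  by apply: filterS => x /= /[apply] ->.
apply: integral_ae_eq => //.
- exact: Radon_Nikodym_SigmaFinite.f_integrable.
- exact/measurable_EFinP.
- by move=> A _ mA; rewrite -Radon_Nikodym_SigmaFinite.f_integral// nuE.
Qed.

Lemma normal_pdfZ (R : realType) (c s x : R) : 0 < c -> s != 0 ->
  normal_pdf 0 (c * s) x = c^-1 * normal_pdf 0 s (c^-1 * x).
Proof.
move=> c0 s0; have c0' : c != 0 by rewrite gt_eqF.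
rewrite !normal_pdfE ?mulf_neq0//.
rewrite /normal_peak /normal_fun !subr0 mulrA; congr (_ * expR _).
  rewrite exprMn -!mulrnAr -[c ^+ 2 * _ * _]mulrA sqrtrM ?sqr_ge0//.
  by rewrite sqrtr_sqr gtr0_norm// invfM.
rewrite !exprMn exprVn -!mulrnAr; field.
by rewrite s0 gt_eqF.
Qed.

Lemma normal_probZ (R : realType) (c s : R) (A : set R) :
  0 < c -> s != 0 -> measurable A ->
  normal_prob 0 (c * s) A = normal_prob 0 s (( *%R c) @^-1` A).
Proof.
move=> c0 s0 mA.
pose phi : measurableTypeR R -> measurableTypeR R := *%R c^-1.
have mphi : measurable_fun setT phi by exact: measurable_funM.
have mB : measurable (( *%R c) @^-1` A).
  by rewrite -[X in measurable X]setTI; exact: measurable_funM.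
pose f x := (c^-1%:E * (normal_pdf 0 s x)%:E)%E.
have mf : measurable_fun setT f.
  apply: measurable_funeM; apply/measurable_EFinP.
  exact: measurable_normal_pdf.
have f0 x : (0 <= f x)%E.
  by rewrite /f -EFinM lee_fin mulr_ge0 ?normal_pdf_ge0// invr_ge0 ltW.
rewrite /normal_prob.
(* Writing [A] as a preimage under [phi] puts the integral in the form required by the pushforward
   formula. *)
have AE : A = phi @^-1` (( *%R c) @^-1` A).
  by apply/seteqP; split=> x; rewrite /phi/= mulVKf ?gt_eqF.
rewrite [in LHS]AE; under eq_integral => x _.
  have -> : (normal_pdf 0 (c * s) x)%:E = (f \o phi) x.
    by rewrite normal_pdfZ// EFinM.
  over.
rewrite -(@ge0_integral_pushforward _ _ _ _ _ _ mphi)//=; last first.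
  exact: measurable_funTS.
(* The pushforward of Lebesgue measure under [phi] is c times Lebesgue measure, and this c cancels
   the c^-1 in [f]. *)
rewrite (eq_measure_integral (mscale (NngNum (ltW c0)) lebesgue_measure)).
  rewrite ge0_integral_mscale//=; last exact: measurable_funTS.
  rewrite -ge0_integralZl//=.
  - apply: eq_integral => x _.
    by rewrite /f -!EFinM mulVKf ?gt_eqF.
  - exact: measurable_funTS.
  - by rewrite lee_fin ltW.
by move=> B mB' _; exact: (lebesgue_measureZ c0 mB').
Qed.

(** * Integrability and expectations under a normal law *)

(** Doubling the standard deviation slows the decay enough to absorb the factor |x|; this gives an
    integrable majorant for the first moment. The factor 2 compensates for the halved peak. *)
Lemma le_norm_normal_pdf (R : realType) (s x : R) : s != 0 ->
  `|x| * normal_pdf 0 s x <= (1 + s ^+ 2 *+ 8) * 2 * normal_pdf 0 (2 * s) x.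
Proof.
move=> s0; rewrite -[_ * 2 * _]mulrA normal_pdfZ// mulVKf// !normal_pdfE//.
rewrite /normal_fun !subr0 mulrCA [leRHS]mulrCA ler_wpM2l ?normal_peak_ge0//.
have s2 : 0 < s ^+ 2 by rewrite exprn_even_gt0.
(* With u = x^2/(8s^2) the two exponentials are e^(-4u) and e^(-u). *)
set u := x ^+ 2 / (s ^+ 2 *+ 8).
have u0 : 0 <= u by rewrite divr_ge0 ?sqr_ge0// mulrn_wge0// ltW.
have xu : x ^+ 2 = s ^+ 2 *+ 8 * u by rewrite /u; field.
have -> : - x ^+ 2 / (s ^+ 2 *+ 2) = - (u *+ 3) - u by rewrite xu; field.
have -> : - (2^-1 * x) ^+ 2 / (s ^+ 2 *+ 2) = - u.
  by rewrite exprMn xu; field.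
rewrite expRD mulrA ler_wpM2r ?expR_ge0// expRN ler_pdivrMr ?expR_gt0//.
(* The chain is |x| <= 1 + x^2 = 1 + 8 s^2 u <= (1 + 8 s^2)(1 + u), with 1 + u <= e^u <= e^(3u). *)
apply: (@le_trans _ _ ((1 + s ^+ 2 *+ 8) * (1 + u))); last first.
  rewrite ler_wpM2l ?addr_ge0 ?mulrn_wge0 ?(ltW s2)//.
  apply: le_trans (expR_ge1Dx _) _; rewrite ler_expR; lra.
have : `|x| <= 1 + x ^+ 2.
  by rewrite -real_normK ?num_real//; nra.
rewrite xu; nra.
Qed.

Lemma integrable_normal_prob_id (R : realType) (s : R) : s != 0 ->
  (normal_prob 0 s).-integrable setT (EFin : R -> \bar R).
Proof.
move=> s0.
have mabs : measurable_fun setT (fun x : R => `|x%:E|%E).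
  apply: measurableT_comp => //; exact: measurable_EFin.
apply/integrableP; split; first exact/measurable_EFinP.
rewrite (@change_of_variables_density _ _ (normal_pdf 0 s))//.
- apply: (@le_lt_trans _ _ (\int[lebesgue_measure]_x
    (((1 + s ^+ 2 *+ 8) * 2)%:E * (normal_pdf 0 (2 * s) x)%:E))%E).
    apply: ge0_le_integral => //=.
    + by move=> x _; rewrite -EFinM lee_fin mulr_ge0// normal_pdf_ge0.
    + apply: emeasurable_funM; first exact: mabs.
      by apply/measurable_EFinP; exact: measurable_normal_pdf.
    + apply: measurable_funeM.
      by apply/measurable_EFinP; exact: measurable_normal_pdf.
    + by move=> x _; rewrite -!EFinM lee_fin le_norm_normal_pdf.
  rewrite integralZl//; last exact: integrable_normal_pdf.
  by rewrite integral_normal_pdf mule1 ltry.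
- exact: measurable_normal_pdf.
- by move=> x; exact: normal_pdf_ge0.
Qed.

(** The pushforward formula is applied to the positive and negative parts separately, which covers
    every measurable [f], integrable or not. *)
Lemma expectation_normal d (T : measurableType d) (R : realType)
    (P : probability T R) (X : {RV P >-> R}) (s : R) (f : R -> R) :
  (forall A, measurable A -> distribution P X A = normal_prob 0 s A) ->
  measurable_fun setT f ->
  ('E_P[f \o X] = \int[normal_prob 0 s]_z (f z)%:E)%E.
Proof.
move=> XE mf; rewrite unlock integralE [RHS]integralE.
have mfE : measurable_fun setT (EFin \o f) by exact/measurable_EFinP.
(* [normal_prob] is a measure on [measurableTypeR R], whose display differs from
   the one of the target [R] of [X]; the measurable sets are convertible. *)
have mX : measurable_fun setT (X : T -> measurableTypeR R).
  have mX0 : measurable_fun setT X by exact: measurable_funPT.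
  by move=> _ B mB; exact: mX0.
have ge0 (g : R -> \bar R) : measurable_fun setT g -> (forall z, 0 <= g z)%E ->
    (\int[P]_w g (X w) = \int[normal_prob 0 s]_z g z)%E.
  move=> mg g0.
  rewrite -[LHS]/(\int[P]_(w in X @^-1` setT) (g \o X) w)%E.
  rewrite -(@ge0_integral_pushforward _ _ _ (measurableTypeR R) _ _ mX)//.
  by apply: eq_measure_integral => A mA _; exact: XE.
have -> : (fun w => ((f \o X) w)%:E) = (EFin \o f) \o X by [].
rewrite funepos_comp funeneg_comp.
congr (_ - _)%E.
  exact: ge0 (measurable_funepos mfE) (funepos_ge0 _).
exact: ge0 (measurable_funeneg mfE) (funeneg_ge0 _).
Qed.

Lemma lipschitz1_measurable (R : realType) (v : R -> R) :
  (forall x y, `|v x - v y| <= `|x - y|) -> measurable_fun setT v.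
Proof.
move=> lipv; apply: continuous_measurable_fun => x.
apply/cvgrPdist_lt => e e0; near=> y.
apply: le_lt_trans (lipv x y) _; near: y.
by apply: cvgr_dist_lt => //; exact: cvg_id.
Unshelve. all: by end_near. Qed.

(** The integrand is dominated by |v a| + |k| |z|. *)
Lemma integrable_normal_prob_lipschitz1 (R : realType) (s a k : R)
    (v : R -> R) :
  s != 0 -> (forall x y, `|v x - v y| <= `|x - y|) ->
  (normal_prob 0 s).-integrable setT (fun z => (v (a + k * z))%:E).
Proof.
move=> s0 lipv.
have mv : measurable_fun setT (fun z : R => v (a + k * z)).
  apply: measurableT_comp; first exact: lipschitz1_measurable.
  by apply: measurable_funD => //; exact: measurable_funM.
pose g : R -> \bar R := ((EFin \o cst `|v a|%R) \+
  (fun z => `|k|%R%:E * `|z%:E|))%E.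
have ig : (normal_prob 0 s).-integrable setT g.
  apply: integrableD; first exact: measurableT.
    by apply: finite_measure_integrable_cst; exact: measurableT.
  apply: (integrableZl measurableT `|k|).
  exact: (integrable_abse (integrable_normal_prob_id s0)).
apply: le_integrable ig => //; first exact/measurable_EFinP.
move=> z _; rewrite /g /= lee_fin [leRHS]ger0_norm; last first.
  by rewrite addr_ge0// mulr_ge0.
rewrite -normrM -lerBlDl (le_trans (lerB_dist _ _))//.
by rewrite (le_trans (lipv _ _))// addrC addKr.
Qed.

(** A coupling argument: with the same shock z on both sides, the integrands differ by at most |a -
    b| pointwise. *)
Lemma normal_mean_contraction (R : realType) (s a b k : R) (v : R -> R) :
  s != 0 -> (forall x y, `|v x - v y| <= `|x - y|) ->
  `|\int[normal_prob 0 s]_z v (a + k * z) -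
    \int[normal_prob 0 s]_z v (b + k * z)| <= `|a - b|.
Proof.
move=> s0 lipv.
have ia := integrable_normal_prob_lipschitz1 a k s0 lipv.
have ib := integrable_normal_prob_lipschitz1 b k s0 lipv.
have iab := integrableB measurableT ia ib.
rewrite -RintegralB//; apply: le_trans (le_normr_Rintegral _ _) _ => //.
have -> : `|a - b| = \int[normal_prob 0 s]_z `|a - b|.
  by rewrite Rintegral_cst//= probability_setT mulr1.
apply: le_Rintegral => //.
- exact: integrable_abse iab.
- exact: finite_measure_integrable_cst.
- by move=> z _; rewrite (le_trans (lipv _ _))// opprD addrACA subrr addr0.
Qed.

(** Multiplication by c, seen as a random variable under [normal_prob 0 s], has law
    [normal_prob 0 (c * s)]. *)
Lemma Rintegral_normal_probZ (R : realType) (c s : R) (f : R -> R) :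
  0 < c -> s != 0 -> measurable_fun setT f ->
  \int[normal_prob 0 (c * s)]_z f z = \int[normal_prob 0 s]_z f (c * z).
Proof.
move=> c0 s0 mf.
have mX : measurable_fun setT ( *%R c : measurableTypeR R -> R).
  exact: measurable_funM.
pose mX' := isMeasurableFun.Build _ _ _ _ _ mX.
pose X : {RV (normal_prob 0 s) >-> R} :=
  HB.pack ( *%R c : measurableTypeR R -> R) mX'.
have XE A : measurable A ->
    distribution (normal_prob 0 s) X A = normal_prob 0 (c * s) A.
  by move=> mA; rewrite normal_probZ.
by rewrite /Rintegral -(expectation_normal XE mf) unlock.
Qed.

(** * Lipschitz bounds and uniqueness of the threshold in one problem *)

Section purchase_problem.
Context {d : measure_display} {Omega : measurableType d} {R : realType}
  {P : probability Omega R}.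
Variables (eps : nat -> {RV P >-> R}) (p : purchase R).
Hypotheses (adm : admissible p) (iid : iid_normal (dt p) eps).

Lemma sqrt_dt_neq0 : Num.sqrt (dt p) != 0.
Proof. by case: adm => dt0 _ _ _; rewrite gt_eqF ?sqrtr_gt0. Qed.

(** The right-hand side no longer mentions the sample space, so problems with shocks on unrelated
    probability spaces can be compared. *)
Lemma expected_next_value (v : R -> R) n x :
  (forall y z, `|v y - v z| <= `|y - z|) ->
  fine 'E_P[fun w => v (price eps p n x 1 w)] =
  \int[normal_prob 0 (Num.sqrt (dt p))]_z
    v (theta p * rate p * dt p + (1 - rate p * dt p) * x + sigma p * z).
Proof.
move=> lipv; rewrite /Rintegral.
rewrite -(expectation_normal (iid.1 n))//=; last first.
  apply: measurableT_comp; first exact: lipschitz1_measurable.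
  by apply: measurable_funD => //; exact: measurable_funM.
by rewrite addn0.
Qed.

Lemma expected_next_value_contraction (v : R -> R) n x y :
  (forall y z, `|v y - v z| <= `|y - z|) ->
  `|fine 'E_P[fun w => v (price eps p n x 1 w)] -
    fine 'E_P[fun w => v (price eps p n y 1 w)]| <=
  `|1 - rate p * dt p| * `|x - y|.
Proof.
move=> lipv; rewrite !expected_next_value//.
apply: le_trans (normal_mean_contraction _ _ _ sqrt_dt_neq0 lipv) _.
by rewrite opprD addrACA subrr add0r -mulrBr normrM.
Qed.

(** By induction: continuing contracts distances, buying now has slope 1, and a minimum of two
    1-Lipschitz functions is 1-Lipschitz. *)
Lemma value_to_go_lipschitz m x y :
  `|value_to_go eps p m x - value_to_go eps p m y| <= `|x - y|.
Proof.
elim: m x y => [//|m IHm] x y /=.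
set n := (_ - _)%N.
have := expected_next_value_contraction n x y IHm.
set a := fine _; set b := fine _ => ab.
have {}ab : `|a - b| <= `|x - y|.
  by apply: le_trans ab _; case: adm => _ _ /ltW + _; exact: ler_piMl.
have /ler_normlP[ab1 ab2] := ab.
have /ler_normlP[xy1 xy2] := lexx `|x - y|.
rewrite /Num.min; case: ltP => ?; case: ltP => ?; apply/ler_normlP; split; lra.
Qed.

Lemma cont_value_contraction n x y :
  `|cont_value eps p n x - cont_value eps p n y| <=
  `|1 - rate p * dt p| * `|x - y|.
Proof.
apply: expected_next_value_contraction; exact: value_to_go_lipschitz.
Qed.

(** Subtracting the equations of two roots cancels the holding costs and leaves |x - y| <= |1 - K
    dt| |x - y|, which forces x = y. *)
Lemma threshold_unique n b :
  cont_value eps p n b = b + holding p n -> threshold eps p n = b.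
Proof.
move=> bE; apply: xget_subset1 => // x y xE yE.
apply/eqP; rewrite -subr_eq0 -normr_eq0; apply: contraT => xy0.
have := cont_value_contraction n x y.
rewrite xE yE opprD addrACA subrr addr0 leNgt gtr_pMl.
  by case: adm => _ _ ->.
by rewrite lt_def xy0 normr_ge0.
Qed.

End purchase_problem.

(** * Comparison of two problems whose prices differ by a factor c *)

Section scaling.
Context {d0 : measure_display} {Omega0 : measurableType d0}
  {d1 : measure_display} {Omega1 : measurableType d1} {R : realType}
  {P0 : probability Omega0 R} {P1 : probability Omega1 R}.
Variables (eps0 : nat -> {RV P0 >-> R}) (eps1 : nat -> {RV P1 >-> R}).
Variables (p0 p1 : purchase R) (c : R) (n : nat).
Hypotheses (adm0 : admissible p0) (adm1 : admissible p1).
Hypotheses (iid0 : iid_normal (dt p0) eps0) (iid1 : iid_normal (dt p1) eps1).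
Hypotheses (c_gt0 : 0 < c) (n_lt : (n < nsteps p0)%N).
(** These are the relations that make the price recursion and the holding costs homogeneous in c.
    The drift is theta K dt with K dt fixed, so theta must carry the factor c; theta = 0 does so
    trivially. *)
Hypotheses (nstepsE : nsteps p1 = nsteps p0) (sigmaE : sigma p1 = sigma p0)
  (thetaE : theta p1 = c * theta p0)
  (sqrt_dtE : Num.sqrt (dt p1) = c * Num.sqrt (dt p0))
  (rate_dtE : rate p1 * dt p1 = rate p0 * dt p0)
  (holdingE : forall i, (n <= i < nsteps p0)%N ->
    holding p1 i = c * holding p0 i).

(** After the substitution of c z for z, drift, reverted price and shock all carry the factor c,
    which [v1] turns into a factor outside the integral. *)
Lemma expected_next_value_scale (v0 v1 : R -> R) k x :
  (forall y z, `|v0 y - v0 z| <= `|y - z|) ->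
  (forall y z, `|v1 y - v1 z| <= `|y - z|) ->
  (forall y, v1 (c * y) = c * v0 y) ->
  fine 'E_P1[fun w => v1 (price eps1 p1 k (c * x) 1 w)] =
  c * fine 'E_P0[fun w => v0 (price eps0 p0 k x 1 w)].
Proof.
move=> lip0 lip1 vE; rewrite !expected_next_value// sqrt_dtE.
rewrite Rintegral_normal_probZ ?sqrt_dt_neq0//; last first.
  apply: measurableT_comp; first exact: lipschitz1_measurable.
  by apply: measurable_funD => //; exact: measurable_funM.
rewrite -RintegralZl//; last first.
  by apply: integrable_normal_prob_lipschitz1 => //; exact: sqrt_dt_neq0.
apply: eq_Rintegral => z _; rewrite -vE; congr v1.
rewrite -mulrA rate_dtE thetaE sigmaE; ring.
Qed.

(** The bound on [m] keeps the time index at least [n], where [holdingE] applies; c > 0 lets the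
    factor pass through the minimum. *)
Lemma value_to_go_scale m x : (m <= nsteps p0 - n)%N ->
  value_to_go eps1 p1 m (c * x) = c * value_to_go eps0 p0 m x.
Proof.
elim: m x => [//|m IHm] x mn /=.
rewrite nstepsE (expected_next_value_scale (v0 := value_to_go eps0 p0 m)).
- rewrite holdingE ?minr_pMr ?(ltW c_gt0) ?mulrDr//; lia.
- exact: value_to_go_lipschitz.
- exact: value_to_go_lipschitz.
- by move=> y; rewrite IHm// ltnW.
Qed.

Lemma cont_value_scale x :
  cont_value eps1 p1 n (c * x) = c * cont_value eps0 p0 n x.
Proof.
apply: expected_next_value_scale.
- exact: value_to_go_lipschitz.
- exact: value_to_go_lipschitz.
- by move=> y; rewrite /value nstepsE value_to_go_scale// leq_sub2l.
Qed.

(* If the threshold equation had no solution, both sides would be the default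
   value [0] of [xget], so existence of the threshold is not an issue. *)
Lemma threshold_scale : threshold eps1 p1 n = c * threshold eps0 p0 n.
Proof.
have eqn x : cont_value eps1 p1 n (c * x) = c * x + holding p1 n <->
    cont_value eps0 p0 n x = x + holding p0 n.
  rewrite cont_value_scale holdingE ?leqnn// -mulrDr.
  split=> [/(mulfI _)-> //|-> //]; exact: lt0r_neq0.
have [[b bE]|noroot] := pselect (exists b,
    cont_value eps0 p0 n b = b + holding p0 n).
  rewrite (threshold_unique adm0 iid0 bE).
  by apply: threshold_unique => //; apply/eqn.
(* A root b of the second equation would give the root c^-1 b of the first. *)
rewrite /threshold !xgetPN ?mulr0// => b bE; apply: noroot; first by exists b.
exists (c^-1 * b); apply/eqn.
by rewrite mulVKf// gt_eqF.
Qed.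

End scaling.

Theorem lemma7 (R : realType) (N n : nat) (sigma dt0 K0 : R)
    (h : nat -> R -> R -> R) :
  (n < N)%N ->
  (forall C : R, 0 < C ->
    admissible (Purchase (C * dt0) (K0 / C) 0 sigma N
                  (fun i => h i (C * dt0) (K0 / C)))) ->
  (forall C : R, 0 < C -> forall i : nat, (n <= i)%N -> (i < N)%N ->
    h i (C * dt0) (K0 / C) = (Num.sqrt C)^-1 * h i dt0 K0) ->
  forall C : R, 0 < C ->
  forall (d0 : measure_display) (Omega0 : measurableType d0)
    (P0 : probability Omega0 R) (eps0 : nat -> {RV P0 >-> R})
    (d1 : measure_display) (Omega1 : measurableType d1)
    (P1 : probability Omega1 R) (eps1 : nat -> {RV P1 >-> R}),
  iid_normal dt0 eps0 ->
  iid_normal (C * dt0) eps1 ->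
  threshold eps1 (Purchase (C * dt0) (K0 / C) 0 sigma N
                    (fun i => h i (C * dt0) (K0 / C))) n =
  Num.sqrt C *
  threshold eps0 (Purchase dt0 K0 0 sigma N (fun i => h i dt0 K0)) n.
Proof.
move=> nN adm hE C C0 d0 Omega0 P0 eps0 d1 Omega1 P1 eps1 iid0 iid1.
(* The original problem is the case C = 1. *)
have adm0 : admissible (Purchase dt0 K0 0 sigma N (fun i => h i dt0 K0)).
  by have := adm 1 ltr01; rewrite mul1r divr1.
have sC0 : 0 < Num.sqrt C by rewrite sqrtr_gt0.
apply: threshold_scale => //=.
- exact: adm.
- by rewrite mulr0.
- by rewrite sqrtrM// ltW.
- by field; rewrite gt_eqF.
- move=> i /andP[ni iN]; rewrite /holding/=.
  have -> : \sum_(i <= j < N) h j (C * dt0) (K0 / C) =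
      (Num.sqrt C)^-1 * \sum_(i <= j < N) h j dt0 K0.
    rewrite mulr_sumr; apply: eq_big_nat => j /andP[ij jN].
    by rewrite hE// (leq_trans ni).
  (* The time step contributes C = (sqrt C)^2 and the unit costs 1 / sqrt C, leaving the factor sqrt
     C. *)
  rewrite -{1}(sqr_sqrtr (ltW C0)); field.
  by rewrite gt_eqF.
Qed.
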